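(* Let $\mathbb{F}$ be a field of characteristic $p>0$ and let $\mathfrak{g}$ be a restricted simple Lie algebra over $\mathbb{F}$ with $\dim\mathfrak{g}=n$ and basis $\{x_1,\dots,x_n\}$. For $i=1,\dots,n$ define $\omega_i:\mathfrak{g}\to\mathbb{F}$ by $$\omega_i\Big(\sum_{j=1}^n\alpha_jx_j\Big)=\alpha_i^p .$$ Then each $(0,\omega_i)$ is a restricted $2$-cocycle, and the restricted cohomology classes represented by $(0,\omega_1),\dots,(0,\omega_n)$ span an $n$-dimensional subspace of $H^2_*(\mathfrak{g})$. Moreover, if $E_i$ denotes the one-dimensional restricted central extension of $\mathfrak{g}$ determined by the cohomology class of the cocycle $(0,\omega_i)$, then $E_i=\mathfrak{g}\oplus\mathbb{F}c$ as an $\mathbb{F}$-vector space, and for all $1\le j,k\le n$, $$[x_j,x_k]=[x_j,x_k]_{\mathfrak{g}},\qquad [x_j,c]=0,\qquad x_j^{[p]}=x_j^{[p]_{\mathfrak{g}}}+\delta_{i,j}\,c,\qquad c^{[p]}=0,$$ where $[x_j,x_k]_{\mathfrak{g}}$ and $x_j^{[p]_{\mathfrak{g}}}$ denote the Lie bracket and the $[p]$-operation in $\mathfrak{g}$, and $\delta_{i,j}$ is the Kronecker delta.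
   Context: A restricted simple Lie algebra over $\mathbb{F}$ is a restricted Lie algebra $(\mathfrak{g},[\cdot,\cdot],(\cdot)^{[p]})$ over $\mathbb{F}$ whose underlying Lie algebra is simple (in particular non-abelian). Write $C^k(\mathfrak{g})$ for the space of alternating $k$-linear maps $\mathfrak{g}^k\to\mathbb{F}$ and $\delta^k:C^k(\mathfrak{g})\to C^{k+1}(\mathfrak{g})$ for the Chevalley–Eilenberg coboundary maps with trivial coefficients, with the sign convention $\delta^1\varphi(g,h)=\varphi([g,h])$. $H^2_*(\mathfrak{g})=H^2_*(\mathfrak{g},\mathbb{F})$ is the second restricted Lie algebra cohomology group with trivial coefficients, computed by restricted cochains as follows. Multiple brackets are left-normed: $[g_1,g_2,\dots,g_k]=[[\dots[[g_1,g_2],g_3],\dots],g_k]$ (with $[g_1]=g_1$). For $\varphi\in C^2(\mathfrak{g})$, a map $\omega:\mathfrak{g}\to\mathbb{F}$ has the $*$-property with respect to $\varphi$ if for all $\alpha\in\mathbb{F}$, $g,h\in\mathfrak{g}$: $\omega(\alpha g)=\alpha^p\omega(g)$ and $$\omega(g+h)=\omega(g)+\omega(h)+\sum_{\substack{g_i\in\{g,h\}\\ g_1=g,\ g_2=h}}\frac{1}{\#(g)}\,\varphi([g_1,\dots,g_{p-1}],g_p),$$ where the sum is over formal sequences $(g_1,\dots,g_p)$ of symbols $g,h$ with $g_1=g$, $g_2=h$, and $\#(g)$ is the number of indices $i$ with $g_i=g$. Restricted $1$-cochains are $C^1_*(\mathfrak{g})=C^1(\mathfrak{g})$; restricted $2$-cochains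 are pairs $(\varphi,\omega)$ with $\varphi\in C^2(\mathfrak{g})$ and $\omega$ having the $*$-property with respect to $\varphi$. The coboundary of $\psi\in C^1_*(\mathfrak{g})$ is $(\delta^1\psi,\ g\mapsto\psi(g^{[p]}))$. A pair $(\varphi,\omega)$ is a restricted cocycle if $\delta^2\varphi=0$ and $\varphi(g,h^{[p]})-\varphi([g,\underbrace{h,\dots,h}_{p-1}],h)=0$ for all $g,h\in\mathfrak{g}$. $H^2_*(\mathfrak{g})$ is restricted $2$-cocycles modulo coboundaries of restricted $1$-cochains. A one-dimensional restricted central extension of $\mathfrak{g}$ is an exact sequence of restricted Lie algebras $0\to\mathbb{F}c\to E\to\mathfrak{g}\to0$ with $c$ central in $E$ and $c^{[p]}=0$. Given a linear section $\sigma:\mathfrak{g}\to E$, the formulas $\varphi(g,h)c=[\sigma(g),\sigma(h)]-\sigma([g,h]_{\mathfrak{g}})$ and $\omega(g)c=\sigma(g)^{[p]}-\sigma(g^{[p]_{\mathfrak{g}}})$ define a restricted $2$-cocycle $(\varphi,\omega)$ whose class in $H^2_*(\mathfrak{g})$ is independent of $\sigma$; this gives a bijection between equivalence classes of one-dimensional restricted central extensions and $H^2_*(\mathfrak{g})$. The extension determined by a class is the one (unique up to equivalence) corresponding to it under this bijection; in $E=\mathfrak{g}\oplus\mathbb{F}c$ the algebra $\mathfrak{g}$ is identified with its image under $\sigma$. *)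

(* Defs.v *)
From HB Require Import structures.
From mathcomp Require Import all_boot all_order all_algebra.
From mathcomp Require Import boolp classical_sets functions.
From mathcomp Require Import ring.

Set Implicit Arguments.
Unset Strict Implicit.
Unset Printing Implicit Defensive.

Import GRing.Theory.
Local Open Scope ring_scope.
Local Open Scope quotient_scope.

HB.mixin Record Lmodule_isLieAlgebra (F : fieldType) L of GRing.Lmodule F L := {
  lie : L -> L -> L;
  lie_linearl : forall y, linear (lie^~ y);
  lie_linearr : forall x, linear (lie x);
  lie_alt : forall x, lie x x = 0;
  lie_jacobi : forall x y z,
    lie x (lie y z) + lie y (lie z x) + lie z (lie x y) = 0
}.

#[short(type="lieAlgType")]
HB.structure Definition LieAlgebra (F : fieldType) :=
  {L of Lmodule_isLieAlgebra F L & GRing.Lmodule F L}.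

Section LieOps.
Variables (F : fieldType) (L : lieAlgType F).

(* Left-normed bracket [g_1, ..., g_k] = [[..[g_1, g_2], ..], g_k]. *)
Definition lbr (s : seq L) : L :=
  if s is x :: s' then foldl (fun y z => lie y z) x s' else 0.

(* A sequence of p symbols g, h is encoded by a tuple of booleans, true
   standing for g; [count id t] is then #(g). *)
Definition symseq (g h : L) (t : seq bool) : seq L :=
  [seq if b then g else h | b <- t].

(* The coefficient of t^i in (ad (t g + h))^k (g), where t is a formal
   variable and ad x = [x, -]. *)
Fixpoint jacobson_coef (g h : L) (k i : nat) : L :=
  match k with
  | 0 => if i == 0%N then g else 0
  | k'.+1 => lie h (jacobson_coef g h k' i)
             + (if i is i'.+1 then lie g (jacobson_coef g h k' i') else 0)
  end.

(* i s_i(g, h) is the coefficient of t^(i-1) in (ad (t g + h))^(p-1) (g). *)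
Definition jacobson_s (p : nat) (g h : L) (i : nat) : L :=
  (i%:R : F)^-1 *: jacobson_coef g h p.-1 i.-1.

End LieOps.

HB.mixin Record LieAlgebra_isRestricted (F : fieldType) (p : nat) L
    of LieAlgebra F L := {
  ppow : L -> L;
  ppowZ : forall (a : F) (g : L), ppow (a *: g) = a ^+ p *: ppow g;
  ppowD : forall g h : L,
    ppow (g + h) = ppow g + ppow h + \sum_(1 <= i < p) jacobson_s p g h i;
  lie_ppow : forall g h : L, lie (ppow g) h = iter p (lie g) h
}.

#[short(type="restrictedLieType")]
HB.structure Definition RestrictedLie (F : fieldType) (p : nat) :=
  {L of LieAlgebra_isRestricted F p L & LieAlgebra F L}.

#[short(type="finRestrictedLieType")]
HB.structure Definition FinRestrictedLie (F : fieldType) (p : nat) :=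
  {L of RestrictedLie F p L & Vector F L}.

Definition lie_ideal (F : fieldType) (p : nat) (L : finRestrictedLieType F p)
    (I : {vspace L}) : Prop :=
  forall x y : L, y \in I -> lie x y \in I.

Definition simple_lie (F : fieldType) (p : nat) (L : finRestrictedLieType F p)
    : Prop :=
  (exists x y : L, lie x y != 0) /\
  (forall I : {vspace L}, lie_ideal I -> I = 0%VS \/ I = fullv).

Section LmodQuotient.
Variables (R : pzRingType) (V : lmodType R) (I : V -> bool).
Hypothesis submodI : submod_closed I.

Definition zmod_of_submod : zmodClosed V :=
  HB.pack I (GRing.isZmodClosed.Build V I (GRing.submod_closedB submodI)).

Definition lmod_quot := Quotient.quot zmod_of_submod.
HB.instance Definition _ := Quotient.on lmod_quot.
HB.instance Definition _ := GRing.Zmodule.on lmod_quot.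

Definition quot_scale (a : R) (u : lmod_quot) : lmod_quot :=
  \pi_lmod_quot (a *: repr u).

Lemma pi_quotD (u v : V) :
  \pi_lmod_quot (u + v) = \pi_lmod_quot u + \pi_lmod_quot v.
Proof. exact: (@Quotient.pi_add V zmod_of_submod u v). Qed.

Lemma pi_quot_scale a (v : V) :
  quot_scale a (\pi_lmod_quot v) = \pi_lmod_quot (a *: v).
Proof.
have Iv : repr (\pi_lmod_quot v) - v \in zmod_of_submod.
  by rewrite Quotient.idealrBE (reprK (\pi_lmod_quot v)).
apply/eqP; rewrite /quot_scale.
rewrite -(@Quotient.idealrBE V zmod_of_submod) -scalerBr.
by case: submodI => I0 IZ; rewrite -[_ *: _]addr0; apply: IZ.
Qed.

Lemma quot_scaleA a b u : quot_scale a (quot_scale b u) = quot_scale (a * b) u.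
Proof. by rewrite [LHS]pi_quot_scale scalerA. Qed.

Lemma quot_scale1 : left_id 1 quot_scale.
Proof. by move=> u; rewrite -[u]reprK pi_quot_scale scale1r. Qed.

Lemma quot_scaleDr : right_distributive quot_scale +%R.
Proof.
move=> a u v; rewrite -[u]reprK -[v]reprK.
by rewrite -pi_quotD !pi_quot_scale scalerDr pi_quotD.
Qed.

Lemma quot_scaleDl u : {morph quot_scale^~ u : a b / a + b}.
Proof.
by move=> a b; rewrite -[u]reprK !pi_quot_scale scalerDl pi_quotD.
Qed.

HB.instance Definition _ := GRing.Zmodule_isLmodule.Build R lmod_quot
  quot_scaleA quot_scale1 quot_scaleDr quot_scaleDl.

End LmodQuotient.

Section RestrictedCohomology.
Variables (F : fieldType) (p : nat) (g : restrictedLieType F p).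

Definition alternating2 (phi : g -> g -> F^o) : Prop :=
  [/\ forall y, linear (phi^~ y), forall x, linear (phi x)
    & forall x, phi x x = 0].

Definition delta1 (psi : g -> F^o) : g -> g -> F^o :=
  fun x y => psi (lie x y).

Definition delta2 (phi : g -> g -> F^o) : g -> g -> g -> F^o :=
  fun x y z => phi (lie x y) z - phi (lie x z) y + phi (lie y z) x.

Definition star_property (phi : g -> g -> F^o) (w : g -> F^o) : Prop :=
  (forall (a : F) (x : g), w (a *: x) = a ^+ p *: w x) /\
  (forall x y : g, w (x + y) = w x + w y +
     \sum_(t : p.-tuple bool | nth false t 0 && ~~ nth true t 1)
        ((count id t)%:R : F)^-1 *:
          phi (lbr (take p.-1 (symseq x y t))) (nth 0 (symseq x y t) p.-1)).

Definition restricted_cochain2 (u : (g -> g -> F^o) * (g -> F^o)) : Prop :=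
  alternating2 u.1 /\ star_property u.1 u.2.

Definition restricted_cocycle2 (u : (g -> g -> F^o) * (g -> F^o)) : Prop :=
  [/\ restricted_cochain2 u,
      forall x y z, delta2 u.1 x y z = 0
    & forall x y, u.1 x (ppow y) - u.1 (lbr (x :: nseq p.-1 y)) y = 0].

Definition cocycle2_pred : {pred (g -> g -> F^o) * (g -> F^o)} :=
  fun u => `[< restricted_cocycle2 u >].

Lemma cocycle2_submod_closed : submod_closed cocycle2_pred.
Proof.
split.
  apply/asboolP; split; last 2 first.
  - by move=> x y z; rewrite /delta2 /= subrr addr0.
  - by move=> x y; rewrite /= subrr.
  split; first by split=> *; rewrite ?[LHS]/=; [move=> ? ? ?|move=> ? ? ?|];
    rewrite /= ?scaler0 ?addr0.
  split=> [a x|x y] /=; first by rewrite scaler0.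
  by rewrite big1 ?addr0 // => t _; rewrite scaler0.
move=> a u v /asboolP[[[ul ur ua] [uZ uD]] ud up].
move=> /asboolP[[[vl vr va] [vZ vD]] vd vp].
have E1 x y : (a *: u + v).1 x y = a *: u.1 x y + v.1 x y by [].
have E2 x : (a *: u + v).2 x = a *: u.2 x + v.2 x by [].
apply/asboolP; split; last 2 first.
- move=> x y z; rewrite /delta2 !E1.
  have -> : forall b1 b2 b3 c1 c2 c3 : F, a * b1 + c1 - (a * b2 + c2)
      + (a * b3 + c3) = a * (b1 - b2 + b3) + (c1 - c2 + c3) by move=> *; ring.
  by have := (ud x y z, vd x y z); rewrite /delta2 => -[-> ->]; rewrite mulr0 addr0.
- by move=> x y; rewrite !E1 opprD addrACA -scalerBr up vp scaler0 addr0.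
split.
  split=> [y b x x'|x b y y'|x]; rewrite !E1.
  - rewrite (ul y b x x') (vl y b x x') !scalerDr !scalerA [b * a]mulrC.
    by rewrite addrACA.
  - rewrite (ur x b y y') (vr x b y y') !scalerDr !scalerA [b * a]mulrC.
    by rewrite addrACA.
  - by rewrite ua va scaler0 addr0.
split=> [b x|x y]; rewrite !E2.
  by rewrite uZ vZ scalerDr !scalerA [a * _]mulrC.
rewrite uD vD.
rewrite (eq_bigr _ (fun t _ => congr1 _ (E1 _ _))).
under eq_bigr do rewrite scalerDr scalerA [_ * a]mulrC -scalerA.
rewrite big_split /= -scaler_sumr.
move: (\sum_(_ | _) _) (\sum_(_ | _) _) => s1 s2.
rewrite /GRing.scale /=; ring.
Qed.

HB.instance Definition _ :=
  GRing.isSubmodClosed.Build F _ cocycle2_pred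
    (GRing.submod_closed_semi cocycle2_submod_closed).

Definition cocycle2 := {u | cocycle2_pred u}.
HB.instance Definition _ := SubChoice.on cocycle2.
HB.instance Definition _ := [SubChoice_isSubLmodule of cocycle2 by <:].

Definition coboundary (psi : g -> F^o) : (g -> g -> F^o) * (g -> F^o) :=
  (delta1 psi, fun x => psi (ppow x)).

Definition coboundary2_pred : cocycle2 -> bool :=
  fun z => `[< exists psi : g -> F^o, linear psi /\ val z = coboundary psi >].

Lemma coboundary2_submod_closed : submod_closed coboundary2_pred.
Proof.
split.
  apply/asboolP; exists (fun=> 0); split; last by [].
  by move=> a x y; rewrite scaler0 addr0.
move=> a u v /asboolP[f [lf uE]] /asboolP[h [lh vE]].
apply/asboolP; exists (fun x => a *: f x + h x); split.
  move=> b x y; rewrite lf lh !scalerDr !scalerA [b * a]mulrC.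
  by rewrite addrACA.
by rewrite GRing.valD GRing.valZ uE vE.
Qed.

Definition H2 := lmod_quot coboundary2_submod_closed.
HB.instance Definition _ := GRing.Lmodule.on H2.

Definition cohomology_class (z : cocycle2) : H2 := \pi_H2 z.

End RestrictedCohomology.

Section Dimension.
Variables (F : fieldType) (V : lmodType F).

Definition span_of m (b : 'I_m -> V) : V -> Prop :=
  fun v => exists a : 'I_m -> F, v = \sum_i a i *: b i.

Definition lin_indep m (b : 'I_m -> V) : Prop :=
  forall a : 'I_m -> F, \sum_i a i *: b i = 0 -> forall i, a i = 0.

Definition has_dim (U : V -> Prop) (m : nat) : Prop :=
  exists b : 'I_m -> V, lin_indep b /\ forall v, U v <-> span_of b v.

End Dimension.

Record central_extension (F : fieldType) (p : nat) (g : restrictedLieType F p)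
    := CentralExtension {
  ext_alg :> restrictedLieType F p;
  ext_proj : ext_alg -> g;
  ext_c : ext_alg;
  ext_proj_linear : linear ext_proj;
  ext_proj_lie : forall x y, ext_proj (lie x y) = lie (ext_proj x) (ext_proj y);
  ext_proj_ppow : forall x, ext_proj (ppow x) = ppow (ext_proj x);
  ext_proj_surj : forall y, exists x, ext_proj x = y;
  ext_c_neq0 : ext_c != 0;
  ext_proj_ker : forall x, ext_proj x = 0 <-> exists a : F, x = a *: ext_c;
  ext_c_central : forall x, lie x ext_c = 0;
  ext_c_ppow : ppow ext_c = 0
}.
Arguments ext_c {F p g} c : rename.

Section Extensions.
Variables (F : fieldType) (p : nat) (g : restrictedLieType F p).

Definition linear_section (E : central_extension g) (sigma : g -> E) : Prop :=
  linear sigma /\ forall x, ext_proj (sigma x) = x.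

Definition section_cochain (E : central_extension g) (sigma : g -> E)
    (u : (g -> g -> F^o) * (g -> F^o)) : Prop :=
  (forall x y, (u.1 x y : F) *: ext_c E
               = lie (sigma x) (sigma y) - sigma (lie x y)) /\
  (forall x, (u.2 x : F) *: ext_c E = ppow (sigma x) - sigma (ppow x)).

Definition determined_by (E : central_extension g) (cl : H2 g) : Prop :=
  exists (sigma : g -> E) (z : cocycle2 g),
    [/\ linear_section sigma, section_cochain sigma (val z)
      & cohomology_class z = cl].

End Extensions.

Definition omega (F : fieldType) (p : nat) (g : finRestrictedLieType F p)
    (n : nat) (x : n.-tuple g) (i : 'I_n) : g -> F^o :=
  fun v => coord x i v ^+ p.

(* Main.v *)
(* Independence comes from simplicity: if a combination of the
   [(0, omega_i)] is the coboundary of [psi], then [psi] kills the derived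
   algebra, which is an ideal and hence all of [g]; so [psi = 0] and evaluating
   at the basis gives zero coefficients.  An extension with class [(0, omega_i)]
   has a section whose cochain is [(0, omega_i) + coboundary psi]; replacing
   [sigma] by [sigma + psi c] removes the coboundary, since [c] is central with
   [c^[p] = 0].  Conversely [g + F c] with [(u, a)^[p] = (u^[p], omega_i u)] is
   such an extension. *)
Require Import Defs.
From HB Require Import structures.
From mathcomp Require Import all_boot all_order all_algebra.
From mathcomp Require Import boolp classical_sets functions.

Set Implicit Arguments.
Unset Strict Implicit.
Unset Printing Implicit Defensive.

Import GRing.Theory.
Local Open Scope ring_scope.

(** * Brackets, central elements and the derived algebra *)

Section LieTheory.
Variables (F : fieldType) (L : lieAlgType F).
Implicit Types x y z c : L.

Lemma lieDl x y z : lie (x + y) z = lie x z + lie y z.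
Proof. by have := lie_linearl z 1 x y; rewrite /= !scale1r. Qed.

Lemma lieDr x y z : lie z (x + y) = lie z x + lie z y.
Proof. by have := lie_linearr z 1 x y; rewrite /= !scale1r. Qed.

Lemma lie0l x : lie 0 x = 0.
Proof. by apply: (addrI (lie 0 x)); rewrite -lieDl !addr0. Qed.

Lemma lie0r x : lie x 0 = 0.
Proof. by apply: (addrI (lie x 0)); rewrite -lieDr !addr0. Qed.

Lemma lieZr (a : F) x y : lie x (a *: y) = a *: lie x y.
Proof. by have := lie_linearr x a y 0; rewrite !addr0 lie0r addr0. Qed.

Lemma lieC x y : lie x y = - lie y x.
Proof.
have := lie_alt (x + y); rewrite lieDl !lieDr !lie_alt add0r addr0.
by move/eqP; rewrite addr_eq0 => /eqP.
Qed.

(** As [c] is central, [ad (t x + c)] equals [t ad x], and this already kills [x]. At exponent 0 the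
    coefficient would be [x] itself, hence [k.+1]. *)
Lemma jacobson_coef_central x c k i :
  (forall y, lie y c = 0) -> jacobson_coef x c k.+1 i = 0.
Proof.
move=> cc; have cl y : lie c y = 0 by rewrite lieC cc oppr0.
elim: k i => [|k IHk] i.
  by case: i => [|[|i]] /=; rewrite cl ?lie_alt ?lie0r addr0.
have -> : jacobson_coef x c k.+2 i = lie c (jacobson_coef x c k.+1 i)
    + (if i is i'.+1 then lie x (jacobson_coef x c k.+1 i') else 0) by [].
by rewrite cl add0r; case: i => // i; rewrite IHk lie0r.
Qed.

End LieTheory.

(** The Jacobson terms involve the power [p.-1] of [ad], a positive exponent because [1 < p], so all
    of them vanish. *)
Lemma ppowD_central (F : fieldType) (p : nat) (L : restrictedLieType F p)
    (x c : L) :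
  (1 < p)%N -> (forall y, lie y c = 0) -> ppow (x + c) = ppow x + ppow c.
Proof.
case: p L x c => [|[|p]] // L x c _ cc.
rewrite ppowD big1 ?addr0 // => i _.
by rewrite /jacobson_s jacobson_coef_central // scaler0.
Qed.

Lemma simple_derived_full (F : fieldType) (p : nat)
    (g : finRestrictedLieType F p) (psi : g -> F^o) :
  simple_lie g -> linear psi -> (forall x y, psi (lie x y) = 0) ->
  forall x, psi x = 0.
Proof.
move=> [[x0 [y0 nab]] simp] psil psi0 x.
pose b := vbasis (fullv : {vspace g}).
(* Brackets of basis vectors span the derived algebra by bilinearity. That [I] contains every
   bracket makes it both an ideal and nonzero. *)
pose I : {vspace g} := <<[seq lie u v | u <- b, v <- b]>>%VS.
have bracketI u v : lie u v \in I.
  rewrite (coord_vbasis (memvf u)) (coord_vbasis (memvf v)).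
  rewrite (big_morph (lie^~ _) (fun s t => lieDl s t _) (lie0l _)).
  apply: memv_suml => i _.
  rewrite (big_morph (lie _) (fun s t => lieDr s t _) (lie0r _)).
  apply: memv_suml => j _.
  (* The left scalar is extracted by swapping the arguments, and the second swap restores their
     order. *)
  rewrite lieZr memvZ // lieC memvN lieZr memvZ // lieC memvN.
  by apply: memv_span; apply: allpairs_f; apply: mem_nth; rewrite size_tuple.
pose f : {linear g -> F^o} :=
  HB.pack psi (GRing.isLinear.Build F g F^o *:%R psi psil).
have fE y : linfun f y = psi y by exact: (lfunE f y).
have subI : (I <= lker (linfun f))%VS.
  apply/span_subvP => _ /allpairsP[[u v] [_ _ ->]] /=.
  by rewrite memv_ker fE psi0.
have [I0|If] := simp I (fun u v _ => bracketI u v).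
  by move: nab; rewrite -memv0 -I0 bracketI.
by apply/eqP; move: (subvP subI x); rewrite If memvf memv_ker fE => ->.
Qed.

(** * Classes in [H2] and cocycles with zero bilinear part *)

Section Cohomology.
Variables (F : fieldType) (p : nat) (g : restrictedLieType F p).

Lemma cohomology_class0 : cohomology_class 0 = 0 :> H2 g.
Proof.
apply: (addrI (cohomology_class 0)).
by rewrite -(pi_quotD (coboundary2_submod_closed g)) !addr0.
Qed.

Lemma cohomology_class_comb m (a : 'I_m -> F) (z : 'I_m -> cocycle2 g) :
  \sum_i a i *: cohomology_class (z i)
  = cohomology_class (\sum_i a i *: z i).
Proof.
have cD u v : cohomology_class (u + v)
    = cohomology_class u + cohomology_class v :> H2 g.
  exact: (pi_quotD (coboundary2_submod_closed g)).
rewrite (big_morph _ cD cohomology_class0); apply: eq_bigr => i _.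
exact: (pi_quot_scale (coboundary2_submod_closed g)).
Qed.

(** Serves twice: with [v = 0] for linear independence, and to compare the cocycle of an arbitrary
    section with a prescribed representative. *)
Lemma eq_cohomology_class (u v : cocycle2 g) :
  cohomology_class u = cohomology_class v ->
  exists2 psi : g -> F^o, linear psi & val u = val v + coboundary psi.
Proof.
move=> /eqP; rewrite /cohomology_class.
rewrite -(@Quotient.idealrBE _ (zmod_of_submod (coboundary2_submod_closed g))).
move=> /asboolP[psi [psil e]]; exists psi => //.
by rewrite -e GRing.valB addrC subrK.
Qed.

Section SemilinearCocycle.
Variable w : g -> F^o.
Hypotheses (wZ : forall a x, w (a *: x) = a ^+ p *: w x)
  (wD : forall x y, w (x + y) = w x + w y).

(** For the zero form the correction sum in [star_property] vanishes, leaving exactly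
    p-semilinearity of [w]; the cocycle identities see only the form. *)
Lemma semilinear_cocycle : cocycle2_pred (fun _ _ => 0, w).
Proof.
apply/asboolP; split=> [|x y z|x y]; rewrite ?/delta2 /= ?subrr ?addr0 //.
split; first by split=> [y a u v|y a u v|//]; rewrite scaler0 addr0.
split=> //= x y; rewrite wD big1 ?addr0 // => t _.
by rewrite scaler0.
Qed.

End SemilinearCocycle.
End Cohomology.

(** * The extension g + F c whose p-power is twisted by [w] *)

Section SplitExtension.
Variables (F : fieldType) (p : nat) (g : restrictedLieType F p).
Variable w : g -> F^o.
Hypotheses (p_gt1 : (1 < p)%N) (wZ : forall a x, w (a *: x) = a ^+ p *: w x)
  (wD : forall x y, w (x + y) = w x + w y).

Definition split_ext := (g * F^o)%type.
HB.instance Definition _ := GRing.Lmodule.on split_ext.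

Definition split_lie (u v : split_ext) : split_ext := (lie u.1 v.1, 0).

Lemma split_lie_linearl v : linear (split_lie^~ v).
Proof.
move=> a x y; rewrite /split_lie /= lie_linearl.
by congr pair; rewrite /= scaler0 addr0.
Qed.

Lemma split_lie_linearr v : linear (split_lie v).
Proof.
move=> a x y; rewrite /split_lie /= lie_linearr.
by congr pair; rewrite /= scaler0 addr0.
Qed.

Lemma split_lie_alt v : split_lie v v = 0.
Proof. by rewrite /split_lie lie_alt. Qed.

Lemma split_lie_jacobi x y z :
  split_lie x (split_lie y z) + split_lie y (split_lie z x)
  + split_lie z (split_lie x y) = 0.
Proof. by congr pair; rewrite /= ?lie_jacobi ?addr0. Qed.

HB.instance Definition _ := Lmodule_isLieAlgebra.Build F split_ext
  split_lie_linearl split_lie_linearr split_lie_alt split_lie_jacobi.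

Definition split_ppow (u : split_ext) : split_ext := (ppow u.1, w u.1).

Lemma split_ppowZ (a : F) u : split_ppow (a *: u) = a ^+ p *: split_ppow u.
Proof. by rewrite /split_ppow /= ppowZ wZ. Qed.

(** From exponent 1 on, a coefficient is a sum of brackets, and brackets have zero second
    component. *)
Lemma split_jacobson_coef (u v : split_ext) k i :
  jacobson_coef u v k.+1 i = (jacobson_coef u.1 v.1 k.+1 i, 0).
Proof.
have fstE l j : (jacobson_coef u v l j).1 = jacobson_coef u.1 v.1 l j.
  by elim: l j => [|l IHl] [|j] //=; rewrite !IHl.
rewrite [LHS]surjective_pairing fstE; congr pair.
by case: i => [|i] /=; rewrite addr0.
Qed.

Lemma split_ppowD u v :
  split_ppow (u + v) = split_ppow u + split_ppow v
    + \sum_(1 <= i < p) jacobson_s p u v i.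
Proof.
have fst_sum (s : seq nat) (G : nat -> split_ext) :
    \sum_(i <- s) G i = (\sum_(i <- s) (G i).1, \sum_(i <- s) (G i).2).
  by apply: (big_rec3 (fun a b c => a = (b, c))) => // i a b c _ ->.
have sE i : jacobson_s p u v i = (jacobson_s p u.1 v.1 i, 0).
  have [k pk] : exists k, p.-1 = k.+1.
    by exists p.-2; case: p p_gt1 => [|[|q]].
  by rewrite /jacobson_s pk split_jacobson_coef; congr pair; rewrite /= scaler0.
rewrite (eq_bigr _ (fun i _ => sE i)) fst_sum /split_ppow /= ppowD wD.
by congr pair; rewrite /= big1_eq addr0.
Qed.

Lemma split_lie_ppow u v : lie (split_ppow u) v = iter p (lie u) v.
Proof.
have fstE k : (iter k (lie u) v).1 = iter k (lie u.1) v.1.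
  by elim: k => //= k ->.
(* Positivity matters: the zeroth iterate is [v], whose second component is arbitrary. *)
have sndE k : (0 < k)%N -> (iter k (lie u) v).2 = 0 by case: k.
by rewrite [RHS]surjective_pairing fstE -lie_ppow sndE // ltnW.
Qed.

HB.instance Definition _ := LieAlgebra_isRestricted.Build F p split_ext
  split_ppowZ split_ppowD split_lie_ppow.

Definition split_c : split_ext := (0, 1).

Lemma semilinear_extension (z : cocycle2 g) :
  val z = (fun _ _ => 0, w) ->
  exists E : central_extension g, determined_by E (cohomology_class z).
Proof.
move=> zE.
have proj_lin : linear (fst : split_ext -> g) by [].
have proj_surj y : exists u : split_ext, u.1 = y by exists (y, 0).
have c_neq0 : split_c != 0 by apply/eqP => -[/eqP]; rewrite oner_eq0.
have proj_ker (u : split_ext) : u.1 = 0 <-> exists a : F, u = a *: split_c.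
  case: u => y a; split=> [/= ->|[b [-> _]]]; last by rewrite scaler0.
  by exists a; congr pair; rewrite /= ?scaler0 // [RHS]mulr1.
have c_central (u : split_ext) : lie u split_c = 0.
  by congr pair; rewrite /= lie0r.
have c_ppow : ppow split_c = 0.
  (* Homogeneity at the scalar 0 then gives [ppow 0 = 0] and [w 0 = 0]. *)
  have p0 : 0 ^+ p = 0 :> F by rewrite expr0n gtn_eqF // ltnW.
  have -> : ppow split_c = (ppow 0, w 0) :> split_ext by [].
  by rewrite -(scale0r 0) ppowZ wZ p0 !scale0r.
pose E : central_extension g := CentralExtension proj_lin
  (fun _ _ => erefl) (fun=> erefl) proj_surj c_neq0 proj_ker c_central c_ppow.
(* The inclusion of the first factor preserves brackets and misses p-powers by exactly [w]. *)
exists E, (fun u => (u, 0) : split_ext), z; split=> //.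
  by split=> // a x y; congr pair; rewrite /= scaler0 addr0.
rewrite zE; split=> x => [y|] /=.
  by rewrite scale0r subrr.
by congr pair; rewrite /= ?scaler0 ?subrr // subr0 [LHS]mulr1.
Qed.

End SplitExtension.

(** * Sections of a central extension *)

Section ChangeOfSection.
Variables (F : fieldType) (p : nat) (g : restrictedLieType F p).
Variable E : central_extension g.

(** Adding multiples of [c] changes neither brackets nor p-powers of lifts; only the subtracted
    terms, the lifts of [lie y y'] and [ppow y], move, which removes [coboundary psi]. *)
Lemma change_section (sigma : g -> E) (u v : (g -> g -> F^o) * (g -> F^o))
    (psi : g -> F^o) :
  (1 < p)%N -> linear psi -> u = v + coboundary psi ->
  linear_section sigma -> section_cochain sigma u ->
  linear_section (fun y => sigma y + (psi y : F) *: ext_c E) /\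
  section_cochain (fun y => sigma y + (psi y : F) *: ext_c E) v.
Proof.
move=> p_gt1 psil uE [sl sP] [u1 u2].
have cc (a : F) y : lie y (a *: ext_c E) = 0.
  by rewrite lieZr ext_c_central scaler0.
have lcc (a : F) y : lie (a *: ext_c E) y = 0 by rewrite lieC cc oppr0.
have pc : ext_proj (ext_c E) = 0.
  by apply/ext_proj_ker; exists 1; rewrite scale1r.
split; split.
- move=> a y y'; rewrite sl psil scalerDl scalerDr scalerA.
  by rewrite addrACA.
- move=> y; rewrite addrC ext_proj_linear pc scaler0 add0r.
  exact: sP.
- move=> y y'; rewrite lieDl !lieDr !cc !lcc !addr0.
  rewrite opprD addrA -u1 uE /= /delta1.
  by rewrite scalerDl addrK.
- move=> y; rewrite ppowD_central // ppowZ ext_c_ppow scaler0 addr0.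
  by rewrite opprD addrA -u2 uE /= scalerDl addrK.
Qed.

(** Existence: [e] minus the lift of its projection lies in the kernel F c. Uniqueness: project,
    then use that [c] is nonzero. *)
Lemma section_decomposition (sigma : g -> E) :
  linear_section sigma ->
  forall e : E, exists! u : g * F, e = sigma u.1 + u.2 *: ext_c E.
Proof.
move=> [sl sP] e.
have projDc y (a : F) : ext_proj (y + a *: ext_c E) = ext_proj y.
  rewrite addrC ext_proj_linear.
  have -> : ext_proj (ext_c E) = 0.
    by apply/ext_proj_ker; exists 1; rewrite scale1r.
  by rewrite scaler0 add0r.
have [|a ea] := (ext_proj_ker (e - sigma (ext_proj e))).1.
  by rewrite addrC -scaleN1r ext_proj_linear sP scaleN1r addNr.
exists (ext_proj e, a); split=> [|[y b] /= ey].
  by rewrite /= -ea addrC subrK.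
have ye : ext_proj e = y by rewrite ey projDc sP.
rewrite ye; congr pair; apply/eqP; rewrite -subr_eq0.
have : (a - b) *: ext_c E == 0.
  by rewrite scalerBl -ea ye [X in X - _ - _]ey addrAC addrK subrr.
by rewrite scaler_eq0 (negPf (ext_c_neq0 E)) orbF.
Qed.

End ChangeOfSection.


Theorem corollary3p2 (F : fieldType) (p : nat) (charF : p \in [pchar F])
    (g : finRestrictedLieType F p) (simple_g : simple_lie g)
    (n : nat) (x : n.-tuple g) (basis_x : basis_of fullv x) :
  exists z : 'I_n -> cocycle2 g,
    [/\ forall i, val (z i) = ((fun _ _ => 0), omega x i),
        has_dim (span_of (fun i => cohomology_class (z i))) n
      & forall i : 'I_n,
          (exists E : central_extension g,
             determined_by E (cohomology_class (z i))) /\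
          (forall E : central_extension g,
             determined_by E (cohomology_class (z i)) ->
             exists sigma : g -> E,
               [/\ linear_section sigma,
                   section_cochain sigma (val (z i)),
                   forall e : E, exists! u : g * F,
                     e = sigma u.1 + u.2 *: ext_c E
                 & forall j k : 'I_n,
                     [/\ lie (sigma x`_j) (sigma x`_k) = sigma (lie x`_j x`_k),
                         lie (sigma x`_j) (ext_c E) = 0,
                         ppow (sigma x`_j)
                           = sigma (ppow x`_j) + (i == j)%:R *: ext_c E
                       & ppow (ext_c E) = 0]])].
Proof.
have p_pr := pcharf_prime charF; have p_gt1 := prime_gt1 p_pr.
have wZ i a y : omega x i (a *: y) = a ^+ p *: omega x i y.
  by rewrite /omega linearZ /= exprMn.
(* Additivity is that of the Frobenius map. *)
have wD i y y' : omega x i (y + y') = omega x i y + omega x i y'.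
  by rewrite /omega linearD -!(pFrobenius_autE charF) rmorphD.
have x_free : free x := basis_free basis_x.
have wx i (j : 'I_n) : omega x i x`_j = (i == j)%:R.
  by rewrite /omega coord_free // -(pFrobenius_autE charF) rmorph_nat eq_sym.
pose z i : cocycle2 g :=
  exist (fun u => cocycle2_pred u) _ (semilinear_cocycle (wZ i) (wD i)).
exists z; split=> [//||i].
  (* The classes themselves are the proposed basis, so only independence is left. *)
  exists (fun i => cohomology_class (z i)); split=> // a.
  rewrite cohomology_class_comb => a0 j.
  rewrite -cohomology_class0 in a0.
  have [psi psil e] := eq_cohomology_class a0.
  (* The combination has zero bilinear part, so [delta1 psi = 0]. *)
  have psi0 y : psi y = 0.
    apply: simple_derived_full simple_g psil _ y => u v.
    suff <- : (val (\sum_i a i *: z i)).1 u v = 0 by rewrite e /= add0r.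
    apply: (big_ind (fun c : cocycle2 g => (val c).1 u v = 0)) => //.
      by move=> c d c0 d0; apply: etrans (congr2 +%R c0 d0) (addr0 0).
    by move=> k _; rewrite /= scaler0.
  (* By [wx], this value is also [a j]. *)
  have : (val (\sum_i a i *: z i)).2 x`_j = 0.
    by rewrite e; apply: etrans (add0r _) (psi0 _).
  rewrite (big_morph (fun c : cocycle2 g => (val c).2 x`_j)
    (id1 := 0) (op1 := +%R)) //=.
  rewrite (eq_bigr (fun k => a k * (k == j)%:R)) => [|k _]; last first.
    by rewrite -[LHS]/(a k * omega x k x`_j) wx.
  rewrite (bigD1 j) //= eqxx mulr1 big1 ?addr0 // => k /negPf ->.
  exact: mulr0.
split; first exact: (semilinear_extension p_gt1 (wZ i) (wD i)).
move=> E [s [u [s_sec su uz]]].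
have [psi psil uE] := eq_cohomology_class uz.
have [t_sec tz] := change_section p_gt1 psil uE s_sec su.
(* The shifted section has cochain exactly [val (z i)], whose two components yield the bracket and
   p-power formulas. *)
exists (fun y => s y + (psi y : F) *: ext_c E); split=> //.
  exact: (section_decomposition t_sec).
move=> j k; have [z1 z2] := tz; split.
- by apply/eqP; rewrite -subr_eq0 -z1 scale0r.
- exact: ext_c_central.
- by have := z2 x`_j; rewrite /= wx => ->; rewrite [RHS]addrC subrK.
- exact: ext_c_ppow.
Qed.
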